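(* Let $(X,d,\mathfrak m)$ be a metric measure space and $\mathscr A$ a good subalgebra of $\mathrm{LIP}_b(X)$. Let $f\in\mathrm{LIP}_b(X)$. Then there exists a sequence $(f_n)_n\subseteq\mathscr A$ such that: (i) $\inf_X f\le f_n\le\sup_X f$ for every $n\in\mathbb N$; (ii) $f_n\to f$ in $L^1(\mathfrak m)$ as $n\to\infty$; (iii) $(\mathrm{lip}_a(f_n))_n$ is dominated in $L^1(\mathfrak m)$, i.e. there exists $G\in L^1(\mathfrak m)$, $G\ge0$, such that $\mathrm{lip}_a(f_n)\le G$ holds $\mathfrak m$-a.e. on $X$ for every $n\in\mathbb N$; (iv) $(\mathrm{lip}_a(f_n)-\mathrm{Lip}(f))^+\to0$ in $L^1(\mathfrak m)$ as $n\to\infty$.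
   Context: A metric measure space is a triple $(X,d,\mathfrak m)$ where $(X,d)$ is a metric space (not assumed complete or separable) and $\mathfrak m\ge 0$ is a finite Radon measure on $X$ (a finite Borel measure that is inner regular with respect to compact sets). For $f:X\to\mathbb R$ and $E\subseteq X$ let $\mathrm{Lip}(f;E)=\sup\{|f(x)-f(y)|/d(x,y): x,y\in E,\ x\ne y\}\in[0,\infty]$ ($\sup\varnothing=0$), and $\mathrm{Lip}(f)=\mathrm{Lip}(f;X)$. For a locally Lipschitz $f$ the asymptotic slope is $\mathrm{lip}_a(f)(x)=\inf_{r>0}\mathrm{Lip}(f;B_r(x))$, where $B_r(x)$ is the open ball. $\mathrm{LIP}_b(X)$ is the algebra of bounded (globally) Lipschitz functions $f:X\to\mathbb R$. For $a\in\mathbb R$, $a^+=\max\{a,0\}$. A subalgebra $\mathscr A$ of $\mathrm{LIP}_b(X)$ is unital if it contains the constant function $1$, and separating if for all $x\ne y$ in $X$ there is $f\in\mathscr A$ with $f(x)\ne f(y)$. A unital separating subalgebra $\mathscr A$ of $\mathrm{LIP}_b(X)$ is good if for every $x\in X$ and $r>0$ there exist $(f_n)_n\subseteq\mathscr A$ and $\rho\in L^\infty(\mathfrak m)$ with $0\le\rho\le1$ such that $\|f_n-d(x,\cdot)\wedge r\|_{L^1(\mathfrak m)}\to0$ and $\mathrm{lip}_a(f_n)\rightharpoonup\rho$ weakly in $L^1(\mathfrak m)$. *)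

(* Defs.v *)
From HB Require Import structures.
From mathcomp Require Import all_boot all_order all_algebra.
From mathcomp Require Import all_classical all_reals all_analysis.

Set Implicit Arguments.
Unset Strict Implicit.
Unset Printing Implicit Defensive.

Import Order.TTheory GRing.Theory Num.Theory.
Import numFieldNormedType.Exports.

Local Open Scope classical_set_scope.
Local Open Scope ring_scope.

(* A metric space whose measurable sets are exactly the Borel sets of the
   metric topology. The library's measurable types are pointed, so such a space
   is nonempty; neither completeness nor separability is assumed. *)
HB.mixin Record Metric_isBorel (d : measure_display) (R : realType) X
    & Measurable d X & Metric R X := {
  measurable_borel : @measurable d X = <<s @open X >>
}.

#[short(type="borelMetricType")]
HB.structure Definition BorelMetric (d : measure_display) (R : realType) :=
  {X of Measurable d X & Metric R X & Metric_isBorel d R X}.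

Section metric_measure.
Context {d : measure_display} {R : realType} {X : borelMetricType d R}.
Implicit Types (m : {finite_measure set X -> \bar R}) (f g : X -> R).

(* The finite measures satisfying this are the finite Radon measures. *)
Definition inner_regular m : Prop :=
  forall B : set X, measurable B ->
    m B = ereal_sup [set m K | K in [set K | compact K /\ K `<=` B]].

(* The element 0 implements the convention that the supremum of the empty set
   of difference quotients is 0; otherwise it does not change the value. *)
Definition Lip f (E : set X) : \bar R :=
  ereal_sup (0%E |`
    [set (`|f p.1 - f p.2| / mdist p.1 p.2)%:E
      | p in [set p : X * X | [/\ E p.1, E p.2 & p.1 <> p.2]]]).

Definition lip_a f (x : X) : \bar R :=
  ereal_inf [set Lip f (ball x r) | r in [set r : R | 0 < r]].

Definition LIPb : set (X -> R) :=
  [set f | bounded_fun f /\ (Lip f setT < +oo)%E].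

Definition subalgebra_LIPb (A : set (X -> R)) : Prop :=
  [/\ A `<=` LIPb, GRing.submod_closed (mem A) & GRing.mulr_2closed (mem A)].

Definition unital (A : set (X -> R)) : Prop := A (cst 1).

Definition separating (A : set (X -> R)) : Prop :=
  forall x y : X, x <> y -> exists2 f, A f & f x <> f y.

Definition cvg_L1 m (u : nat -> X -> \bar R) (l : X -> \bar R) : Prop :=
  [/\ forall n, m.-integrable setT (u n),
      m.-integrable setT l
    & ('N[m]_1[u n \- l])%E @[n --> \oo] --> 0%E].

(* Integrable functions are not identified up to m-a.e. equality here, but the
   bound below forces a functional to respect that identification. *)
Notation L1 m := (LfunType m (Order.le_refl (1%E : \bar _))).

Definition continuous_functional m (phi : {scalar L1 m}) : Prop :=
  exists C : R, forall h : L1 m,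
    (`|phi h|%:E <= C%:E * 'N[m]_1[EFin \o h])%E.

Definition weak_cvg_L1 m (u : nat -> X -> \bar R) (l : X -> \bar R) : Prop :=
  exists (U : nat -> L1 m) (L : L1 m),
    [/\ forall n, EFin \o U n = u n,
        EFin \o L = l
      & forall phi : {scalar L1 m}, continuous_functional phi ->
          phi (U n) @[n --> \oo] --> phi L].

Definition good_subalgebra m (A : set (X -> R)) : Prop :=
  [/\ subalgebra_LIPb A, unital A, separating A
    & forall (x : X) (r : R), 0 < r ->
        exists (f_ : nat -> X -> R) (rho : X -> R),
          [/\ forall n, A (f_ n),
              rho \in Lfun m +oo%E /\ {ae m, forall y, 0 <= rho y <= 1},
              cvg_L1 m (fun n => EFin \o f_ n)
                (fun y => (Num.min (mdist x y) r)%:E)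
            & weak_cvg_L1 m (fun n => lip_a (f_ n)) (EFin \o rho)]].

End metric_measure.

(* Main.v *)
(* Sublinearity of the slope and Mazur's lemma (here: the Mazur-Orlicz theorem
   applied to [h |-> \int h^+]) turn the weak convergence in the definition of a
   good subalgebra into a strong one: truncated distances are L^1-limits of
   functions of [A] whose slopes exceed 1 by a quantity that is small in L^1.
   The functions with this property for a bound [L] are stable under affine maps
   and under minima, since [min(u, v) = (u + v - |u - v|) / 2] and Bernstein
   polynomials of [|.|] are 1-Lipschitz. McShane's formula
   [f = min_i (f(y_i) + L d(y_i, .))], up to a small error on a compact set of
   almost full measure, then reaches every [f] in LIP_b. A Bernstein polynomial
   of a clamping function enforces the bounds [inf f], [sup f], and a summable
   rate of approximation yields the dominating function. *)
Require Import Defs.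
From HB Require Import structures.
From mathcomp Require Import all_boot all_order all_algebra.
From mathcomp Require Import all_classical all_reals all_analysis.
From mathcomp Require Import measurable_realfun.
From mathcomp Require Import ring lra.

Set Implicit Arguments.
Unset Strict Implicit.
Unset Printing Implicit Defensive.

Import Order.TTheory GRing.Theory Num.Theory.
Import numFieldNormedType.Exports.

Local Open Scope classical_set_scope.
Local Open Scope ring_scope.

(** * The Mazur-Orlicz theorem *)

Section mazur_orlicz.
Context {R : realType} {V : lmodType R}.
Implicit Types (p q : V -> R) (D : set V) (delta : R).

Definition sublinear p : Prop :=
  (forall x y, p (x + y) <= p x + p y) /\
  (forall t x, 0 <= t -> p (t *: x) <= t * p x).

Lemma sublinear0 p : sublinear p -> p 0 = 0.
Proof.
move=> [pD pZ]; apply/eqP; rewrite eq_le.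
have := pZ 0 0 (lexx _); rewrite scale0r mul0r => ->/=.
by have := pD 0 0; rewrite addr0; lra.
Qed.

Lemma sublinear_oppr_ge p x : sublinear p -> - p (- x) <= p x.
Proof.
move=> sp; have := sp.1 x (- x); rewrite subrr sublinear0//; lra.
Qed.

Definition mo_values p D delta (h : V) : set R :=
  [set r | exists t c, [/\ 0 <= t, D c & r = p (h + t *: c) - t * delta]].

(* A linear functional is below this one iff it is below [p] and at least
   [delta] on [D]. *)
Definition mo_inf p D delta (h : V) : R := inf (mo_values p D delta h).

Definition convex_subset D : Prop :=
  forall x y t, D x -> D y -> 0 <= t -> t <= 1 -> D (t *: x + (1 - t) *: y).

Section mo_inf.
Variables (p : V -> R) (D : set V) (delta : R).
Hypotheses (sp : sublinear p) (D0 : D !=set0) (cD : convex_subset D).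
Hypothesis pD : forall c, D c -> delta <= p c.

(** Rescaling by [t^-1] extends [pD] to the cone over [D]: [p (t *: c) >= t * delta]. Subadditivity
    then bounds the set below, without which the real [inf] would be a junk value. *)
Lemma mo_values_lbound h : lbound (mo_values p D delta h) (- p (- h)).
Proof.
move=> _ [t [c [t0 Dc ->]]].
have h1 : t * delta <= p (t *: c).
  move: t0; rewrite le_eqVlt => /orP[/eqP<-|t0].
    by rewrite scale0r mul0r sublinear0.
  have := sp.2 t^-1 (t *: c); rewrite scalerA mulVf ?gt_eqF// scale1r invr_ge0.
  move=> /(_ (ltW t0)); rewrite ler_pdivlMl//; apply: le_trans.
  by rewrite ler_pM2l// pD.
have := sp.1 (h + t *: c) (- h).
rewrite addrAC subrr add0r; lra.
Qed.

Lemma mo_inf_le h t c : 0 <= t -> D c ->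
  mo_inf p D delta h <= p (h + t *: c) - t * delta.
Proof.
move=> t0 Dc; apply: ge_inf; last by exists t, c.
by exists (- p (- h)); exact: mo_values_lbound.
Qed.

Lemma le_mo_inf h z :
  (forall t c, 0 <= t -> D c -> z <= p (h + t *: c) - t * delta) ->
  z <= mo_inf p D delta h.
Proof.
move=> H; apply: lb_le_inf.
  by case: D0 => c Dc; exists (p (h + 0 *: c) - 0 * delta), 0, c.
by move=> _ [t [c [t0 Dc ->]]]; exact: H.
Qed.

(** Convexity of [D] enters through subadditivity: [t1 *: c1 + t2 *: c2] is [t1 + t2] times a single
    point of [D]. *)
Lemma mo_inf_sublinear : sublinear (mo_inf p D delta).
Proof.
split=> [x y|s x s0].
  rewrite -lerBlDr; apply: le_mo_inf => t1 c1 t10 D1.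
  rewrite lerBlDl -lerBlDr; apply: le_mo_inf => t2 c2 t20 D2.
  rewrite lerBlDl.
  have [c Dc cE] : exists2 c, D c & t1 *: c1 + t2 *: c2 = (t1 + t2) *: c.
    have [t0|t0] := eqVneq (t1 + t2) 0.
      have -> : t1 = 0 by lra.
      have -> : t2 = 0 by lra.
      by exists c1; rewrite // addr0 !scale0r addr0.
    have tp : 0 < t1 + t2 by rewrite lt_neqAle eq_sym t0/= addr_ge0.
    exists ((t1 / (t1 + t2)) *: c1 + (1 - t1 / (t1 + t2)) *: c2).
      apply: cD => //; first by rewrite divr_ge0// ltW.
      by rewrite ler_pdivrMr// mul1r lerDl.
    rewrite scalerDr !scalerA; congr (_ *: _ + _ *: _); by field.
  apply: (le_trans (mo_inf_le _ (addr_ge0 t10 t20) Dc)).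
  rewrite -cE addrACA; have := sp.1 (x + t1 *: c1) (y + t2 *: c2); lra.
move: s0; rewrite le_eqVlt => /orP[/eqP<-|s0].
  case: D0 => c Dc; rewrite scale0r mul0r.
  apply: (le_trans (mo_inf_le _ (lexx 0) Dc)).
  by rewrite scale0r addr0 sublinear0// mul0r subr0.
rewrite -ler_pdivrMl//; apply: le_mo_inf => t c t0 Dc.
rewrite ler_pdivrMl//.
apply: (le_trans (mo_inf_le _ (mulr_ge0 (ltW s0) t0) Dc)).
rewrite -scalerA -scalerDr; have := sp.2 s (x + t *: c) (ltW s0); lra.
Qed.

Lemma mo_inf_le_id h : mo_inf p D delta h <= p h.
Proof.
case: D0 => c Dc; apply: (le_trans (mo_inf_le _ (lexx 0) Dc)).
by rewrite scale0r addr0 mul0r subr0.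
Qed.

(** At [t = 1] the shift by [c] cancels [- c]. A linear functional below [mo_inf] is therefore at
    least [delta] on [D]. *)
Lemma mo_inf_oppr c : D c -> mo_inf p D delta (- c) <= - delta.
Proof.
move=> Dc; apply: (le_trans (mo_inf_le _ ler01 Dc)).
by rewrite scale1r addNr sublinear0// mul1r add0r.
Qed.

End mo_inf.

(** Zorn's lemma: the pointwise infimum over a nonempty chain is sublinear, and it is finite because
    every sublinear [s] below [p] satisfies [- p (- x) <= s x]. *)
Lemma minimal_sublinear p : sublinear p ->
  exists q, [/\ sublinear q, forall x, q x <= p x &
    forall r, sublinear r -> (forall x, r x <= q x) -> r = q].
Proof.
move=> sp.
pose T := {q : V -> R | sublinear q /\ forall x, q x <= p x}.
(* The order is reversed, so that a maximal element is a minimal functional. *)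
pose R' (s t : T) := `[< forall x, sval t x <= sval s x >].
have [||||[q [sq qp]] qmin] := @Zorn T R'.
- by move=> t; apply/asboolP.
- move=> r s t /asboolP rs /asboolP st; apply/asboolP => x.
  exact: le_trans (st x) (rs x).
- move=> [s s'] [t t'] /asboolP/= st /asboolP/= ts.
  have E : s = t by apply/funext => x; apply/eqP; rewrite eq_le st ts.
  by rewrite E in s' st ts *; congr exist; exact: Prop_irrelevance.
- move=> F Ftot.
  have [[t0 Ft0]|F0] := pselect (F !=set0); last first.
    exists (exist _ p (conj sp (fun x => lexx _))) => s Fs.
    by exfalso; apply: F0; exists s.
  pose S x := [set sval s x | s in F].
  pose q x := inf (S x).
  have q_le s x : F s -> q x <= sval s x.
    move=> Fs; apply: ge_inf; last by exists s.
    exists (- p (- x)) => _ [u Fu <-].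
    case: u {Fu} => u [su up]/=.
    by apply: le_trans (sublinear_oppr_ge x su); rewrite lerN2.
  have le_q x z : (forall s, F s -> z <= sval s x) -> z <= q x.
    move=> H; apply: lb_le_inf; first by exists (sval t0 x), t0.
    by move=> _ [s Fs <-]; exact: H.
  have sq : sublinear q.
    split=> [x y|t x t_ge0].
      rewrite -lerBlDr; apply: (le_q) => s1 F1.
      rewrite lerBlDl -lerBlDr; apply: (le_q) => s2 F2; rewrite lerBlDl.
      (* Two members of a chain are comparable, so the subadditivity of the smaller one applies. *)
      have [s [Fs s_1 s_2]] : exists s, [/\ F s, forall x, sval s x <= sval s1 x
          & forall x, sval s x <= sval s2 x].
        have [/asboolP le12|/asboolP le21] := Ftot _ _ F1 F2.
          by exists s2.
        by exists s1.
      apply: (le_trans (q_le s _ Fs)); apply: (le_trans ((svalP s).1.1 x y)).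
      exact: lerD.
    move: t_ge0; rewrite le_eqVlt => /orP[/eqP<-|t_gt0].
      rewrite scale0r mul0r; apply: (le_trans (q_le _ _ Ft0)).
      by rewrite sublinear0//; exact: (svalP t0).1.
    rewrite -ler_pdivrMl//; apply: (le_q) => s Fs; rewrite ler_pdivrMl//.
    by apply: (le_trans (q_le s _ Fs)); apply: (svalP s).1.2; exact: ltW.
  have qp x : q x <= p x.
    by apply: (le_trans (q_le t0 _ Ft0)); exact: (svalP t0).2.
  exists (exist _ q (conj sq qp)) => s Fs; apply/asboolP => x /=; exact: q_le.
exists q; split=> // r sr rq.
have rp x : r x <= p x by apply: le_trans (rq x) (qp x).
have := qmin (exist _ r (conj sr rp)).
by move=> /(_ (asboolT rq)) /(congr1 sval).
Qed.

(* A minimal sublinear functional [q] is linear: [mo_inf q [set x] (q x)] is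
   again sublinear and below [q], and its value at [- x] is at most [- q x],
   so minimality makes [q] odd. *)
Lemma sublinear_dominates_linear p : sublinear p ->
  exists phi : {scalar V}, forall x, phi x <= p x.
Proof.
move=> /minimal_sublinear[q [sq qp qmin]].
have qN x : q (- x) = - q x.
  have c1 : convex_subset [set x].
    move=> _ _ t -> -> _ _ /=.
    by rewrite -scalerDl addrCA subrr addr0 scale1r.
  have x0 : [set x] !=set0 by exists x.
  have qx c : [set x] c -> q x <= q c by move=> ->.
  have := qmin _ (mo_inf_sublinear sq x0 c1 qx) (mo_inf_le_id sq x0 qx).
  move=> E; have := mo_inf_oppr sq qx (erefl x); rewrite E => h.
  apply/eqP; rewrite eq_le h/=.
  by have := sublinear_oppr_ge x sq; lra.
have qD x y : q (x + y) = q x + q y.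
  apply/eqP; rewrite eq_le sq.1/=.
  have := sq.1 (- x) (- y); rewrite -opprD !qN; lra.
have qZ0 t x : 0 <= t -> q (t *: x) = t * q x.
  move=> t0; apply/eqP; rewrite eq_le sq.2//=.
  by have := sq.2 t (- x) t0; rewrite scalerN !qN mulrN lerN2.
have qZ t x : q (t *: x) = t * q x.
  have [/qZ0//|t0] := leP 0 t.
  rewrite -[t]opprK scaleNr qN qZ0 ?mulNr//; lra.
have lin : linear_for *%R q by move=> t x y; rewrite qD qZ.
pose phi : {scalar V} := HB.pack q (GRing.isLinear.Build R V R *%R q lin).
by exists phi.
Qed.

Lemma mazur_orlicz p D delta : sublinear p -> D !=set0 -> convex_subset D ->
  (forall c, D c -> delta <= p c) ->
  exists phi : {scalar V}, (forall x, phi x <= p x) /\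
    forall c, D c -> delta <= phi c.
Proof.
move=> sp D0 cD pD.
have [phi phile] := sublinear_dominates_linear (mo_inf_sublinear sp D0 cD pD).
exists phi; split=> [x|c Dc].
  exact: le_trans (phile x) (mo_inf_le_id sp D0 pD x).
have := le_trans (phile (- c)) (mo_inf_oppr sp pD Dc).
by rewrite raddfN lerN2.
Qed.

End mazur_orlicz.

(** * Bernstein polynomials *)

Section bernstein.
Context {R : realType}.
Implicit Types (c : nat -> R) (x y : R).

(* De Casteljau's recursion for the Bernstein polynomial
   [\sum_(k <= n) 'C(n, k) x^k (1 - x)^(n - k) c k]. *)
Fixpoint bernstein n c x : R :=
  if n is n'.+1 then
    (1 - x) * bernstein n' c x + x * bernstein n' (fun k => c k.+1) x
  else c 0%N.

Lemma ler_bernstein n c1 c2 x : 0 <= x <= 1 -> (forall k, c1 k <= c2 k) ->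
  bernstein n c1 x <= bernstein n c2 x.
Proof.
move=> /andP[x0 x1]; elim: n c1 c2 => [|n IH] c1 c2 c12 //=.
by rewrite lerD// ler_wpM2l// ?subr_ge0//; apply: IH.
Qed.

Lemma bernstein_cst n a x : bernstein n (fun=> a) x = a.
Proof. by elim: n => //= n ->; ring. Qed.

Lemma bernsteinB n c1 c2 x :
  bernstein n (fun k => c1 k - c2 k) x = bernstein n c1 x - bernstein n c2 x.
Proof. by elim: n c1 c2 => //= n IH c1 c2; rewrite !IH; ring. Qed.

Lemma bernsteinZ n a c x :
  bernstein n (fun k => a * c k) x = a * bernstein n c x.
Proof. by elim: n c => //= n IH c; rewrite !IH; ring. Qed.

Lemma bernsteinD n c1 c2 x :
  bernstein n (fun k => c1 k + c2 k) x = bernstein n c1 x + bernstein n c2 x.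
Proof. by elim: n c1 c2 => //= n IH c1 c2; rewrite !IH; ring. Qed.

(** Second moment about [a] of a binomial variable with parameters [n] and [x]: variance plus
    squared bias. *)
Lemma bernstein_variance n a x :
  bernstein n (fun k => (k%:R - a) ^+ 2) x =
  n%:R * x * (1 - x) + (n%:R * x - a) ^+ 2.
Proof.
elim: n a => [|n IH] a /=; first by ring.
rewrite IH.
(* Shifting the index amounts to replacing [a] by [a - 1]. *)
under [in X in _ + x * X]eq_fun do rewrite -natr1 -addrA -[1 - a]opprB.
rewrite (_ : (fun k => _) = (fun k => (k%:R - (a - 1)) ^+ 2)); last by [].
by rewrite IH -natr1; ring.
Qed.

Lemma bernstein_dist_le n c1 c2 x e : 0 <= x <= 1 ->
  (forall k, `|c1 k - c2 k| <= e) -> `|bernstein n c1 x - bernstein n c2 x| <= e.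
Proof.
move=> x01 c12; rewrite -bernsteinB ler_norml; apply/andP; split.
  rewrite -[leLHS](bernstein_cst n _ x); apply: ler_bernstein => // k.
  by have := c12 k; rewrite ler_norml => /andP[].
rewrite -[leRHS](bernstein_cst n _ x); apply: ler_bernstein => // k.
by have := c12 k; rewrite ler_norml => /andP[].
Qed.

(** Each de Casteljau step adds one term in [x - y] whose other factor averages the increments
    [c k.+1 - c k]; hence the factor [n]. *)
Lemma bernstein_lipschitz n c e x y : 0 <= x <= 1 -> 0 <= y <= 1 ->
  (forall k, `|c k.+1 - c k| <= e) ->
  `|bernstein n c x - bernstein n c y| <= n%:R * e * `|x - y|.
Proof.
move=> x01 y01; elim: n c => [|n IH] c ce; first by rewrite /= subrr normr0 !mul0r.
have -> : bernstein n.+1 c x - bernstein n.+1 c y =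
    (1 - x) * (bernstein n c x - bernstein n c y) +
    x * (bernstein n (fun k => c k.+1) x - bernstein n (fun k => c k.+1) y) +
    (x - y) * (bernstein n (fun k => c k.+1) y - bernstein n c y).
  by rewrite /=; ring.
have h1 := IH _ ce.
have h2 := IH (fun k => c k.+1) (fun k => ce k.+1).
have h3 := bernstein_dist_le n y01 ce.
case/andP: x01 => x0 x1.
have x1' : 0 <= 1 - x by lra.
rewrite (le_trans (ler_normD _ _))// (le_trans (lerD (ler_normD _ _) (lexx _)))//.
rewrite !normrM (ger0_norm x0) (ger0_norm x1').
have := ler_wpM2l x1' h1; have := ler_wpM2l x0 h2.
have := ler_wpM2l (normr_ge0 (x - y)) h3.
rewrite -[in X in _ -> _ -> _ -> X]natr1; lra.
Qed.

(** Weierstrass approximation with a rate: under the binomial weights the node [k / n] has mean [x]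
    and variance at most [1 / n], so precision [e] is reached with about [K^2 / e^2] nodes. *)
Lemma bernstein_cvg n (phi : R -> R) (K e x : R) : 0 <= K -> 0 < e ->
  (forall s t, `|phi s - phi t| <= K * `|s - t|) -> 0 <= x <= 1 ->
  K ^+ 2 <= n%:R * e ^+ 2 -> (0 < n)%N ->
  `|bernstein n (fun k => phi (k%:R / n%:R)) x - phi x| <= e.
Proof.
move=> K0 e0 phiK x01 Kn n0.
have n0R : 0 < n%:R :> R by rewrite ltr0n.
(* AM-GM: [K s <= e / 2 + K^2 s^2 / (2 e)] linearises the absolute value. *)
pose b k := e / 2 + K ^+ 2 / (2 * e * n%:R ^+ 2) * (k%:R - n%:R * x) ^+ 2.
have bk k : `|phi (k%:R / n%:R) - phi x| <= b k.
  apply: (le_trans (phiK _ _)); set s := `|_ - _|.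
  have -> : b k = (e ^+ 2 + (K * s) ^+ 2) / (2 * e).
    rewrite /b exprMn /s real_normK ?num_real//.
    by field; rewrite !gt_eqF.
  rewrite ler_pdivlMr; last by lra.
  by have := sqr_ge0 (e - K * s); lra.
have bE : bernstein n b x <= e.
  rewrite bernsteinD bernstein_cst bernsteinZ bernstein_variance subrr expr0n/= addr0.
  suff : K ^+ 2 / (2 * e * n%:R ^+ 2) * (n%:R * x * (1 - x)) <= e / 2 by lra.
  have -> : K ^+ 2 / (2 * e * n%:R ^+ 2) * (n%:R * x * (1 - x)) =
      K ^+ 2 * (x * (1 - x)) / (2 * e * n%:R) by field; rewrite !gt_eqF.
  rewrite ler_pdivrMr ?mulr_gt0//.
  apply: (@le_trans _ _ (K ^+ 2 * 1)); last by lra.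
  by rewrite ler_wpM2l ?sqr_ge0//; case/andP: x01 => ? ?; nra.
rewrite -[X in `|_ - X|](bernstein_cst n _ x) -bernsteinB.
rewrite ler_norml -{1}(opprK (bernstein n _ x)) lerN2; apply/andP; split.
  rewrite -mulN1r -bernsteinZ; apply: le_trans bE; apply: ler_bernstein => // k.
  by rewrite mulN1r; have := bk k; rewrite ler_norml lerNl => /andP[].
apply: le_trans bE; apply: ler_bernstein => // k.
by have := bk k; rewrite ler_norml => /andP[].
Qed.

End bernstein.

(** * Asymptotic slopes *)

Section slope.
Context {d : measure_display} {R : realType} {X : borelMetricType d R}.
Implicit Types (f g u v : X -> R) (c r : R) (x y : X) (E : set X).

Definition lipschitz_bound f c E :=
  forall x y, E x -> E y -> `|f x - f y| <= c * mdist x y.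

Lemma ballP x r y : ball x r y = (mdist x y < r) :> Prop.
Proof. by rewrite ballEmdist. Qed.

Lemma lipschitz_boundS f c E F : F `<=` E ->
  lipschitz_bound f c E -> lipschitz_bound f c F.
Proof. by move=> FE fE x y Fx Fy; apply: fE; apply: FE. Qed.

Lemma lipschitz_bound_le f c c' E : c <= c' ->
  lipschitz_bound f c E -> lipschitz_bound f c' E.
Proof.
move=> cc' fE x y Ex Ey; apply: le_trans (fE x y Ex Ey) _.
by rewrite ler_wpM2r// mdist_ge0.
Qed.

Lemma Lip_ge0 f E : (0 <= Lip f E)%E.
Proof. by apply: ereal_sup_ubound; left. Qed.

(** Replaces suprema in [\bar R] by real inequalities free of division. The element [0] in the
    supremum is why [c] has to be nonnegative. *)
Lemma Lip_leP f E c : 0 <= c ->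
  (Lip f E <= c%:E)%E <-> lipschitz_bound f c E.
Proof.
move=> c0; split=> [fc x y Ex Ey|fE].
  have [->|xy] := eqVneq x y; first by rewrite subrr normr0 mulr_ge0// mdist_ge0.
  rewrite -ler_pdivrMr ?mdist_gt0// -lee_fin; apply: le_trans fc.
  by apply: ereal_sup_ubound; right; exists (x, y) => //; split => //; apply/eqP.
apply: ge_ereal_sup => _ [->|[[x y] [/= Ex Ey xy] <-]]; first by rewrite lee_fin.
by rewrite lee_fin ler_pdivrMr ?mdist_gt0 ?fE//; apply/eqP.
Qed.

Lemma lip_a_le_Lip f x r : 0 < r -> (lip_a f x <= Lip f (ball x r))%E.
Proof. by move=> r0; apply: ereal_inf_lbound; exists r. Qed.

Lemma lip_a_ge0 f x : (0 <= lip_a f x)%E.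
Proof. by apply: le_ereal_inf_tmp => _ [r _ <-]; exact: Lip_ge0. Qed.

Lemma LIPb_lipschitz f : LIPb f ->
  0 <= fine (Lip f setT) /\ lipschitz_bound f (fine (Lip f setT)) setT.
Proof.
move=> [_ fy]; have f0 := Lip_ge0 f setT; split; first exact: fine_ge0.
by apply/Lip_leP; rewrite ?fine_ge0// fineK// ge0_fin_numE.
Qed.

Lemma LIPb_fineK f : LIPb f -> (fine (Lip f setT))%:E = Lip f setT.
Proof. by move=> [_ fy]; rewrite fineK// ge0_fin_numE// Lip_ge0. Qed.

Lemma LIPb_bounded f : LIPb f -> exists2 M : R, 0 <= M & forall x, `|f x| <= M.
Proof.
move=> [[M [Mr fM]] _]; exists (`|M| + 1); first by rewrite addr_ge0.
by move=> x; apply: fM => //; rewrite ltr_pwDr// real_ler_norm.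
Qed.

(* Junk value 0 where [lip_a f x] is infinite; meaningful for [LIPb f]. *)
Definition slope f x : R := fine (lip_a f x).

(** Finiteness comes from the global Lipschitz constant, which bounds the one on the unit ball. *)
Lemma slopeE f x : LIPb f -> (slope f x)%:E = lip_a f x.
Proof.
move=> [_ fy]; rewrite fineK// ge0_fin_numE ?lip_a_ge0//.
apply: le_lt_trans fy; apply: le_trans (lip_a_le_Lip f x ltr01) _.
have /andP[] : (0 <= Lip f (ball x 1) <= Lip f setT)%E; last by [].
rewrite Lip_ge0/=; apply: ge_ereal_sup => z zL; apply: ereal_sup_ubound.
by case: zL => [->|[p [? ? ?] <-]]; [left|right; exists p].
Qed.

Lemma slope_ge0 f x : 0 <= slope f x.
Proof. by rewrite fine_ge0// lip_a_ge0. Qed.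

Lemma slope_le f x c r : LIPb f -> 0 < r -> 0 <= c ->
  lipschitz_bound f c (ball x r) -> slope f x <= c.
Proof.
move=> fL r0 c0 fc; rewrite -lee_fin slopeE//.
by apply: le_trans (lip_a_le_Lip f x r0) _; exact/Lip_leP.
Qed.

(** The infimum defining the slope need not be attained; a strict upper bound yields an actual
    ball. *)
Lemma slope_lt f x c : LIPb f -> slope f x < c ->
  exists2 r : R, 0 < r & lipschitz_bound f c (ball x r).
Proof.
move=> fL fc; have c0 : 0 <= c by apply: ltW; apply: le_lt_trans fc; exact: slope_ge0.
have : (lip_a f x < c%:E)%E by rewrite -slopeE// lte_fin.
move=> /ereal_inf_lt[_ [r r0 <-] /ltW fr]; exists r => //.
exact/Lip_leP.
Qed.

Lemma slope_le_lipschitz f c x : LIPb f -> 0 <= c -> lipschitz_bound f c setT ->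
  slope f x <= c.
Proof.
by move=> fL c0 fc; apply: (slope_le fL ltr01 c0); exact: lipschitz_boundS fc.
Qed.

Lemma slope_cst (a : R) x : LIPb (cst a : X -> R) -> slope (cst a) x = 0.
Proof.
move=> aL; apply/eqP; rewrite eq_le slope_ge0 andbT.
apply: slope_le_lipschitz => // y z _ _.
by rewrite subrr normr0 mul0r.
Qed.

(* Strict upper bounds of [slope u x] and [slope v x] are Lipschitz constants
   of [u] and [v] on a common ball. *)
Lemma slope_le2 f u v x (F : R -> R -> R) : LIPb f -> LIPb u -> LIPb v ->
  (forall a b e : R, 0 <= a -> 0 <= b -> 0 <= e -> F (a + e) (b + e) <= F a b + F e e) ->
  (forall e : R, 0 < e -> exists2 e' : R, 0 < e' & F e' e' <= e) ->
  (forall a b : R, 0 <= a -> 0 <= b -> 0 <= F a b) ->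
  (forall a b E, lipschitz_bound u a E -> lipschitz_bound v b E ->
    lipschitz_bound f (F a b) E) ->
  slope f x <= F (slope u x) (slope v x).
Proof.
move=> fL uL vL FD Fe F0 H; apply/ler_addgt0Pr => e e0.
have [e' e'0 e'e] := Fe e e0.
have ux : slope u x < slope u x + e' by rewrite ltrDl.
have vx : slope v x < slope v x + e' by rewrite ltrDl.
have [r1 r10 ur] := slope_lt uL ux; have [r2 r20 vr] := slope_lt vL vx.
have r0 : 0 < Num.min r1 r2 by rewrite lt_min r10 r20.
have u0 := slope_ge0 u x; have v0 := slope_ge0 v x.
apply: (@le_trans _ _ (F (slope u x + e') (slope v x + e'))); last first.
  apply: (le_trans (FD _ _ _ u0 v0 (ltW e'0))); exact: lerD.
apply: (slope_le fL r0); first by apply: F0; rewrite addr_ge0// ltW.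
apply: H; [apply: lipschitz_boundS ur|apply: lipschitz_boundS vr] => y;
  by rewrite !ballP lt_min => /andP[].
Qed.

Lemma slope_le_max f u v x : LIPb f -> LIPb u -> LIPb v ->
  (forall y z, `|f y - f z| <= Num.max `|u y - u z| `|v y - v z|) ->
  slope f x <= Num.max (slope u x) (slope v x).
Proof.
move=> fL uL vL fuv.
apply: (slope_le2 _ fL uL vL (F := fun a b => Num.max a b)).
- by move=> a b e a0 b0 e0; rewrite maxxx addr_maxl.
- by move=> e e0; exists e; rewrite // maxxx.
- by move=> a b a0 b0; rewrite le_max a0.
move=> a b E ua vb y z Ey Ez; apply: le_trans (fuv y z) _.
by rewrite maxr_pMl ?mdist_ge0// ge_max !le_max ua//= vb// orbT.
Qed.

Lemma slope_le_comp f u x : LIPb f -> LIPb u ->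
  (forall y z, `|f y - f z| <= `|u y - u z|) -> slope f x <= slope u x.
Proof.
move=> fL uL fu; rewrite -[leRHS]maxxx; apply: slope_le_max => // y z.
by rewrite maxxx.
Qed.

Lemma slopeD (a b : R) u v x : 0 <= a -> 0 <= b -> LIPb u -> LIPb v ->
  LIPb (fun y => a * u y + b * v y) ->
  slope (fun y => a * u y + b * v y) x <= a * slope u x + b * slope v x.
Proof.
move=> a0 b0 uL vL fL.
apply: (slope_le2 _ fL uL vL (F := fun s t => a * s + b * t)).
- by move=> s t e _ _ _; lra.
(* The summand [1] keeps the denominator positive when [a = b = 0]. *)
- move=> e e0; exists (e / (a + b + 1)); first by rewrite divr_gt0// ltr_wpDl// addr_ge0.
  have ab : 0 < a + b + 1 by lra.
  by rewrite /= -mulrDl mulrA ler_pdivrMr// [leRHS]mulrC ler_pM2r// lerDl.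
- by move=> s t s0 t0; rewrite addr_ge0// mulr_ge0.
move=> s t E us vt y z Ey Ez.
have -> : a * u y + b * v y - (a * u z + b * v z) =
  a * (u y - u z) + b * (v y - v z) by ring.
apply: (le_trans (ler_normD _ _)); rewrite /= !normrM (ger0_norm a0) (ger0_norm b0).
have := ler_wpM2l a0 (us y z Ey Ez); have := ler_wpM2l b0 (vt y z Ey Ez).
by rewrite mulrDl !mulrA; lra.
Qed.

Lemma open_ballP (U : set X) :
  (forall x, U x -> exists2 r : R, 0 < r & ball x r `<=` U) -> open U.
Proof.
move=> H; rewrite openE => x /H[r r0 rU]; rewrite /interior.
by apply/nbhs_ballP; exists r.
Qed.

Lemma open_ball x r : open (ball x r).
Proof.
apply: open_ballP => y; rewrite ballP => xy; exists (r - mdist x y).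
  by rewrite subr_gt0.
move=> z; rewrite !ballP => yz.
by apply: (le_lt_trans (metric_triangle x y z)); rewrite -ltrBrDl.
Qed.

Lemma open_measurable_borel (U : set X) : open U -> measurable U.
Proof. by move=> oU; rewrite measurable_borel; exact: sub_sigma_algebra. Qed.

(** Strict sublevel sets of an upper semicontinuous function are open, hence Borel, and open
    half-lines generate the Borel sets of the line. *)
Lemma measurable_usc (g : X -> R) :
  (forall c x, g x < c ->
    exists2 r : R, 0 < r & forall y, ball x r y -> g y < c) ->
  measurable_fun setT g.
Proof.
move=> gusc; apply: (measurability (@RGenInftyO.G R)).
  exact: RGenInftyO.measurableE.
move=> _ [_ [c ->] <-]; rewrite setTI; apply: open_measurable_borel.
apply: open_ballP => x /=; rewrite in_itv/= => /gusc[r r0 H].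
by exists r => // y /H; rewrite /= in_itv.
Qed.

Lemma measurable_LIPb f : LIPb f -> measurable_fun setT f.
Proof.
move=> /LIPb_lipschitz[]; set L := fine _ => L0 fL.
apply: measurable_usc => c x fc; exists ((c - f x) / (L + 1)).
  by rewrite divr_gt0 ?subr_gt0//; lra.
move=> y; rewrite ballP ltr_pdivlMr; last lra.
have := fL x y I I; have := mdist_ge0 x y; rewrite ler_norml => ? /andP[].
nra.
Qed.

(** The slope is upper semicontinuous: a Lipschitz constant on a ball also serves on smaller balls
    inside it. *)
Lemma measurable_slope f : LIPb f -> measurable_fun setT (slope f).
Proof.
move=> fL; apply: measurable_usc => c x fc.
(* The midpoint leaves room for a strict inequality at nearby points. *)
pose c' := (slope f x + c) / 2.
have [r r0 fr] : exists2 r : R, 0 < r & lipschitz_bound f c' (ball x r).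
  by apply: slope_lt => //; rewrite /c'; lra.
exists r => // y xy.
have ry : 0 < r - mdist x y by rewrite subr_gt0 -ballP.
suff : slope f y <= c' by rewrite /c'; lra.
apply: (slope_le fL ry).
  by have := slope_ge0 f x; rewrite /c'; lra.
apply: lipschitz_boundS fr => z; rewrite !ballP => yz.
by apply: (le_lt_trans (metric_triangle x y z)); rewrite -ltrBrDl.
Qed.

Lemma lipschitz_LIPb f M c : (forall x, `|f x| <= M) ->
  lipschitz_bound f c setT -> LIPb f.
Proof.
move=> fM fc; split.
  exists M; split; first exact: num_real.
  by move=> N MN x _; exact: le_trans (fM x) (ltW MN).
apply: (@le_lt_trans _ _ `|c|%:E); last exact: ltry.
by apply/Lip_leP => //; apply: lipschitz_bound_le fc; exact: ler_norm.
Qed.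

Lemma LIPb_min f g : LIPb f -> LIPb g -> LIPb (fun x => Num.min (f x) (g x)).
Proof.
move=> fL gL; have [M M0 fM] := LIPb_bounded fL; have [N N0 gN] := LIPb_bounded gL.
have [L0 fl] := LIPb_lipschitz fL; have [K0 gl] := LIPb_lipschitz gL.
apply: (@lipschitz_LIPb _ (M + N) (fine (Lip f setT) + fine (Lip g setT))) => [x|x y _ _].
  have := fM x; have := gN x; rewrite !ler_norml.
  by case: (leP (f x) (g x)) => _ /andP[? ?] /andP[? ?]; apply/andP; split; lra.
have := fl x y I I; have := gl x y I I; have := mdist_ge0 x y.
rewrite mulrDl; set a := _ * mdist x y; set b := _ * mdist x y => xy.
have a0 : 0 <= a by exact: mulr_ge0.
have b0 : 0 <= b by exact: mulr_ge0.
rewrite !ler_norml => /andP[? ?] /andP[? ?].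
by apply/andP; split; case: (leP (f x) (g x)) => ?; case: (leP (f y) (g y)) => ?; lra.
Qed.

Lemma LIPb_cst (a : R) : LIPb (cst a : X -> R).
Proof.
apply: (@lipschitz_LIPb _ `|a| 0) => // x y _ _.
by rewrite subrr normr0 mul0r.
Qed.

Lemma LIPb_affine (a b : R) f : LIPb f -> LIPb (fun x => a + b * f x).
Proof.
move=> fL; have [M M0 fM] := LIPb_bounded fL; have [L0 fl] := LIPb_lipschitz fL.
apply: (@lipschitz_LIPb _ (`|a| + `|b| * M) (`|b| * fine (Lip f setT))) => [x|x y _ _].
  by rewrite (le_trans (ler_normD _ _))// lerD2l normrM ler_wpM2l.
by rewrite opprD addrACA subrr add0r -mulrBr normrM -mulrA ler_wpM2l// fl.
Qed.

Lemma LIPb_dist x r : 0 < r -> LIPb (fun y => Num.min (mdist x y) r).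
Proof.
move=> r0; apply: (@lipschitz_LIPb _ r 1) => [y|y z _ _].
  rewrite ger0_norm ?ge_min ?lexx ?orbT//.
  by rewrite le_min mdist_ge0 ltW.
have := metric_triangle x y z; have := metric_triangle x z y.
rewrite (metric_sym z y) mul1r ler_norml.
have := mdist_ge0 y z.
by case: (leP (mdist x y) r) => ?; case: (leP (mdist x z) r) => ?; lra.
Qed.

End slope.

(** * Polynomial operations in a subalgebra *)

Section subalgebra.
Context {d : measure_display} {R : realType} {X : borelMetricType d R}.
Variable (A : set (X -> R)).
Hypotheses (sA : subalgebra_LIPb A) (uA : unital A).
Implicit Types (f g u v h : X -> R) (x y : X).

Lemma subalgebra_LIP u : A u -> LIPb u.
Proof. by case: sA => AL _ _; exact: AL. Qed.

Lemma subalgebra_lin (a b : R) u v : A u -> A v -> A (fun x => a * u x + b * v x).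
Proof.
case: sA => _ [A0 AD] _ Au Av.
have bv : b *: v \in mem A.
  by rewrite -[b *: v]addr0; apply: AD => //; exact: mem_set.
by have := AD a u _ (mem_set Au) bv => /set_mem.
Qed.

Lemma subalgebra_mul u v : A u -> A v -> A (fun x => u x * v x).
Proof.
case: sA => _ _ AM Au Av.
by have := AM _ _ (mem_set Au) (mem_set Av) => /set_mem.
Qed.

Lemma subalgebra_affine (a b : R) u : A u -> A (fun x => a + b * u x).
Proof.
move=> Au; have := subalgebra_lin a b uA Au.
by under eq_fun do rewrite mulr1.
Qed.

(** De Casteljau's recursion uses only affine maps, products and sums, so no expansion into
    monomials is required. *)
Lemma subalgebra_bernstein n (c : nat -> R) u : A u ->
  A (fun x => bernstein n c (u x)).
Proof.
move=> Au; elim: n c => [|n IH] c /=.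
  by have := subalgebra_affine (c 0%N) 0 Au; under eq_fun do rewrite mul0r addr0.
have A1 := subalgebra_mul (subalgebra_affine 1 (-1) Au) (IH c).
have A2 := subalgebra_mul Au (IH (fun k => c k.+1)).
have := subalgebra_lin 1 1 A1 A2.
by under eq_fun do rewrite !mul1r mulN1r.
Qed.

(** A Bernstein polynomial of [phi], taken on an interval containing the range of [h], keeps both
    the Lipschitz constant 1 and the bounds of [phi]. *)
Lemma subalgebra_comp (phi : R -> R) h e : A h -> 0 < e ->
  (forall s t, `|phi s - phi t| <= `|s - t|) ->
  exists g, [/\ A g, forall x, `|g x - phi (h x)| <= e,
    forall x y, `|g x - g y| <= `|h x - h y| &
    forall lo hi, (forall t, lo <= phi t <= hi) -> forall x, lo <= g x <= hi].
Proof.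
move=> Ah e0 phi1; have [M M0 hM] := LIPb_bounded (subalgebra_LIP Ah).
(* Length of the interval from [- (M + 1)] to [M + 1], positive even if [M = 0]; [s] maps it
   affinely onto the unit interval. *)
pose w := 2 * (M + 1); have w0 : 0 < w by rewrite /w; lra.
have wn0 : w != 0 by rewrite gt_eqF.
pose s x := (M + 1) / w + w^-1 * h x.
have s01 x : 0 <= s x <= 1.
  have -> : s x = (M + 1 + h x) / w by rewrite /s; field.
  rewrite ler_pdivrMr// mul1r divr_ge0 /=; last exact: ltW.
    by have := hM x; rewrite /w ler_norml => /andP[? ?]; lra.
  by have := hM x; rewrite /w ler_norml => /andP[? ?]; lra.
pose psi t := phi (w * t - (M + 1)).
have psiw a b : `|psi a - psi b| <= w * `|a - b|.
  apply: le_trans (phi1 _ _) _.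
  by rewrite opprB addrA subrK -mulrBr normrM (gtr0_norm w0).
pose n := (Num.truncn (w ^+ 2 / e ^+ 2)).+1.
have n0 : 0 < n%:R :> R by rewrite ltr0n.
have nw : w ^+ 2 <= n%:R * e ^+ 2.
  rewrite -ler_pdivrMr ?exprn_gt0//; apply: ltW; exact: truncnS_gt.
have psis x : psi (s x) = phi (h x) by congr phi; rewrite /s; field.
exists (fun x => bernstein n (fun k => psi (k%:R / n%:R)) (s x)); split.
- by apply: subalgebra_bernstein; exact: subalgebra_affine.
- by move=> x; rewrite -psis; apply: (bernstein_cvg (ltW w0)).
- move=> x y.
  (* Consecutive coefficients differ by at most [w / n], so the polynomial is [w]-Lipschitz in [s];
     the factor [w^-1] in [s] compensates. *)
  apply: (le_trans (@bernstein_lipschitz _ n _ (w / n%:R) _ _ (s01 x) (s01 y) _)).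
    move=> k; apply: (le_trans (psiw _ _)).
    rewrite -mulrBl -natr1 addrAC subrr add0r mul1r gtr0_norm// invr_gt0//.
  rewrite /s opprD addrACA subrr add0r -mulrBr normrM gtr0_norm ?invr_gt0//.
  by rewrite [n%:R * _]mulrC divfK ?gt_eqF// mulrA mulfV// mul1r.
- move=> lo hi lohi x; apply/andP; split.
    rewrite -[leLHS](bernstein_cst n _ (s x)); apply: ler_bernstein => // k.
    by case/andP: (lohi (w * (k%:R / n%:R) - (M + 1))).
  rewrite -[leRHS](bernstein_cst n _ (s x)); apply: ler_bernstein => // k.
  by case/andP: (lohi (w * (k%:R / n%:R) - (M + 1))).
Qed.

(** For increments [a] of [u] and [b] of [v], [(|a + b| + |a - b|) / 2 = max(|a|, |b|)]; so the
    approximate minimum obeys the same Lipschitz bound as the exact one. *)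
Lemma subalgebra_min u v e : A u -> A v -> 0 < e ->
  exists g, [/\ A g, forall x, `|g x - Num.min (u x) (v x)| <= e &
    forall x y, `|g x - g y| <= Num.max `|u x - u y| `|v x - v y|].
Proof.
move=> Au Av e0.
have Auv := subalgebra_lin 1 (-1) Au Av.
have [h [Ah habs hlip _]] := subalgebra_comp Auv e0 (@ler_dist_dist R R).
exists (fun x => 1 * (2^-1 * u x + 2^-1 * v x) + - 2^-1 * h x); split.
- by apply: subalgebra_lin => //; exact: subalgebra_lin.
- move=> x; have := habs x; rewrite mul1r mulN1r !ler_norml => /andP[].
  case: (leP (u x) (v x)) => uv.
    by rewrite ler0_norm ?subr_le0// => ? ?; lra.
  by rewrite gtr0_norm ?subr_gt0// => ? ?; lra.
move=> x y; have := hlip x y; rewrite !mul1r !mulN1r => hxy.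
have : `|h x - h y| <= `|(u x - u y) - (v x - v y)|.
  apply: le_trans hxy _; rewrite le_eqVlt; apply/orP; left; apply/eqP.
  by congr `|_|; ring.
move Eh : (h x - h y) => dh; move Eu : (u x - u y) => du.
move Ev : (v x - v y) => dv dle.
have -> : 2^-1 * u x + 2^-1 * v x + - 2^-1 * h x -
   (2^-1 * u y + 2^-1 * v y + - 2^-1 * h y) = (du + dv - dh) / 2.
  by rewrite -Eh -Eu -Ev; field.
have du_max : `|du| <= Num.max `|du| `|dv| by rewrite le_max lexx.
have dv_max : `|dv| <= Num.max `|du| `|dv| by rewrite le_max lexx orbT.
move: (Num.max _ _) du_max dv_max => M.
move: dle; case: (leP 0 (du - dv)) => duv.
  rewrite (ger0_norm duv) !ler_norml => /andP[? ?] /andP[? ?] /andP[? ?].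
  by apply/andP; split; lra.
rewrite (ltr0_norm duv) !ler_norml => /andP[? ?] /andP[? ?] /andP[? ?].
by apply/andP; split; lra.
Qed.

End subalgebra.

(** * Integrability of bounded Lipschitz functions and of their slopes *)

Section integrals.
Context {d : measure_display} {R : realType} {X : borelMetricType d R}.
Variable m : {finite_measure set X -> \bar R}.
Implicit Types (f g h : X -> R) (x y : X).

Lemma bounded_integrable f (M : R) : measurable_fun setT f ->
  (forall x, `|f x| <= M) -> m.-integrable setT (EFin \o f).
Proof.
move=> mf fM; apply: measurable_bounded_integrable => //.
  by rewrite ltey_eq fin_num_measure.
exists M; split; first exact: num_real.
by move=> N MN x _; exact: le_trans (fM x) (ltW MN).
Qed.

Lemma LIPb_integrable f : LIPb f -> m.-integrable setT (EFin \o f).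
Proof.
move=> fL; have [M _ fM] := LIPb_bounded fL.
exact: bounded_integrable (measurable_LIPb fL) fM.
Qed.

Lemma dist_integrable f g : LIPb f -> LIPb g ->
  m.-integrable setT (EFin \o (fun x => `|f x - g x|)).
Proof.
move=> fL gL; apply: integrable_norm.
apply: (integrableB measurableT (LIPb_integrable fL) (LIPb_integrable gL)).
Qed.

(** The slope lies between 0 and the global Lipschitz constant, so the excess is bounded, and [m] is
    finite. *)
Lemma excess_integrable f (L : R) : LIPb f ->
  m.-integrable setT (EFin \o (fun x => Num.max (slope f x - L) 0)).
Proof.
move=> fL; have [K0 fK] := LIPb_lipschitz fL.
apply: (@bounded_integrable _ (fine (Lip f setT) + `|L|)).
  apply: measurable_maxr => //; apply: measurable_funB => //.
  exact: measurable_slope.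
move=> x; have := slope_le_lipschitz x fL K0 fK; have := slope_ge0 f x.
have := ler_norm (- L); rewrite normrN => ? ? ?.
rewrite ger0_norm ?le_max ?lexx ?orbT// ge_max; apply/andP; split; last first.
  exact: addr_ge0.
lra.
Qed.

Lemma ae_le_Rintegral f g : (forall x, 0 <= f x) -> (forall x, 0 <= g x) ->
  m.-integrable setT (EFin \o f) -> m.-integrable setT (EFin \o g) ->
  {ae m, forall x, f x <= g x} ->
  \int[m]_x f x <= \int[m]_x g x.
Proof.
move=> f0 g0 fi gi fg; apply: fine_le; rewrite ?integrable_fin_num//.
apply: ae_ge0_le_integral => //.
- by move=> x _; rewrite lee_fin.
- exact: measurable_int fi.
- by move=> x _; rewrite lee_fin.
- exact: measurable_int gi.
by apply: filterS fg => x ? _; rewrite lee_fin.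
Qed.

Lemma Lnorm1_Rintegral f : m.-integrable setT (EFin \o f) ->
  'N[m]_1[EFin \o f]%E = (\int[m]_x `|f x|)%:E.
Proof.
move=> fi; rewrite Lnorm1 /Rintegral fineK//.
by apply: integrable_fin_num => //; exact: integrable_norm.
Qed.

End integrals.

(** * Functions approximable with slope at most L *)

Section real_inequalities.
Context {R : realType}.

Lemma dist_min_le (a b a' b' : R) :
  `|Num.min a b - Num.min a' b'| <= `|a - a'| + `|b - b'|.
Proof.
have := ler_norm (a - a'); have := ler_norm (b - b').
have := ler_norm (- (a - a')); have := ler_norm (- (b - b')).
rewrite !normrN ler_norml.
by case: (leP a b) => ?; case: (leP a' b') => ? ? ? ? ?; apply/andP; split; lra.
Qed.

Lemma quarters3_le (e : R) : 0 < e -> e / 4 + (e / 4 + e / 4) <= e.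
Proof. by move=> e0; lra. Qed.

Lemma quarters2_le (e : R) : 0 < e -> e / 4 + e / 4 <= e.
Proof. by move=> e0; lra. Qed.

Lemma max0D_le (a b : R) : Num.max (a + b) 0 <= Num.max a 0 + Num.max b 0.
Proof.
by case: (leP a 0) => ?; case: (leP b 0) => ?; rewrite ge_max; apply/andP; split; lra.
Qed.

(** The threshold [L] is the same on both sides, which makes a fixed slope bound stable under
    minima. *)
Lemma excess_le_max (s a b L : R) : s <= Num.max a b ->
  Num.max (s - L) 0 <= Num.max (a - L) 0 + Num.max (b - L) 0.
Proof.
move=> sab; have a0 : 0 <= Num.max (a - L) 0 by rewrite le_max lexx orbT.
have b0 : 0 <= Num.max (b - L) 0 by rewrite le_max lexx orbT.
rewrite ge_max addr_ge0// andbT.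
have aL : a - L <= Num.max (a - L) 0 by rewrite le_max lexx.
have bL : b - L <= Num.max (b - L) 0 by rewrite le_max lexx.
move: sab; rewrite le_max => /orP[] ?.
  by apply: (le_trans _ (lerD aL b0)); rewrite addr0 lerD2r.
by apply: (le_trans _ (lerD a0 bL)); rewrite add0r lerD2r.
Qed.

End real_inequalities.

Section approximable.
Context {d : measure_display} {R : realType} {X : borelMetricType d R}.
Variables (m : {finite_measure set X -> \bar R}) (A : set (X -> R)).
Hypotheses (sA : subalgebra_LIPb A) (uA : unital A).
Implicit Types (F G f g u v : X -> R) (L e : R).

Definition approximable L F : Prop := forall e, 0 < e ->
  exists g, [/\ A g, \int[m]_x `|g x - F x| <= e &
    \int[m]_x Num.max (slope g x - L) 0 <= e].

Let AL : A `<=` LIPb. Proof. by move=> u; exact: subalgebra_LIP. Qed.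

Let mass_ge0 : 0 <= fine (m setT). Proof. exact: fine_ge0. Qed.

Lemma Rintegral_le_cstD (c : R) f g : 0 <= c ->
  m.-integrable setT (EFin \o f) -> m.-integrable setT (EFin \o g) ->
  (forall x, f x <= c + g x) ->
  \int[m]_x f x <= c * fine (m setT) + \int[m]_x g x.
Proof.
move=> c0 fi gi fcg.
have ci : m.-integrable setT (EFin \o cst c).
  exact: finite_measure_integrable_cst.
rewrite -(Rintegral_cst m measurableT) -RintegralD//.
apply: le_Rintegral => //.
have := integrableD measurableT ci gi; apply: eq_integrable => //.
Qed.

Lemma approximable_cst (a : R) L : 0 <= L -> approximable L (cst a).
Proof.
move=> L0 e e0; exists (cst a); split.
- have := subalgebra_affine sA uA a 0 uA.
  by under eq_fun do rewrite mul0r addr0.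
- rewrite (_ : (fun _ => _) = cst 0); last first.
    by apply/funext => x /=; rewrite subrr normr0.
  by rewrite Rintegral_cst// mul0r ltW.
rewrite (_ : (fun _ => _) = cst 0); last first.
  apply/funext => x /=; rewrite slope_cst; last exact: LIPb_cst.
  by apply: max_r; rewrite sub0r oppr_le0.
by rewrite Rintegral_cst// mul0r ltW.
Qed.

Lemma slope_affine (a b : R) u x : 0 <= b -> LIPb u ->
  slope (fun y => a + b * u y) x <= b * slope u x.
Proof.
move=> b0 uL.
have buL : LIPb (fun y => b * u y + 0 * u y).
  rewrite (_ : (fun y => _) = (fun y => 0 + b * u y)); first exact: LIPb_affine.
  by apply/funext => y; ring.
have := slopeD x b0 (lexx 0) uL uL buL; rewrite mul0r addr0; apply: le_trans.
apply: slope_le_comp => //; first exact: LIPb_affine.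
by move=> y z; rewrite !mul0r !addr0 opprD addrACA subrr add0r.
Qed.

Lemma approximable_affine (a b : R) L F : 0 <= b -> LIPb F ->
  approximable L F -> approximable (b * L) (fun x => a + b * F x).
Proof.
move=> b0 FL LF e e0.
(* Dividing [e] by [b + 1] instead of [b] also covers [b = 0]. *)
have b1 : 0 < b + 1 by lra.
have [g [Ag gF gL]] := LF (e / (b + 1)) (divr_gt0 e0 b1).
have gLIP := AL Ag.
have be : b * (e / (b + 1)) <= e.
  by rewrite mulrA ler_pdivrMr// mulrC ler_pM2l// lerDl.
exists (fun x => a + b * g x); split; first exact: subalgebra_affine.
- rewrite (_ : (fun _ => _) = (fun x => b * `|g x - F x|)); last first.
    apply/funext => x; rewrite opprD addrACA subrr add0r -mulrBr normrM.
    by rewrite (ger0_norm b0).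
  rewrite RintegralZl//; last exact: dist_integrable.
  by apply: le_trans be; exact: ler_wpM2l.
have H := RintegralZl b measurableT (excess_integrable m L gLIP).
apply: (@le_trans _ _ (\int[m]_x (b * Num.max (slope g x - L) 0))).
  apply: le_Rintegral => //.
  - by apply: excess_integrable; apply: AL; exact: subalgebra_affine.
  - have := integrableZl measurableT b (excess_integrable m L gLIP).
    by apply: eq_integrable.
  move=> x _; rewrite maxr_pMr// mulr0 mulrBr.
  by rewrite ge_max !le_max lexx orbT andbT lerD2r slope_affine.
by rewrite H; apply: le_trans be; exact: ler_wpM2l.
Qed.

Lemma approximable_min L F G : LIPb F -> LIPb G ->
  approximable L F -> approximable L G ->
  approximable L (fun x => Num.min (F x) (G x)).
Proof.
move=> FL GL LF LG e e0.
have e4 : 0 < e / 4 by lra.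
have [u [Au uF uL]] := LF _ e4; have [v [Av vG vL]] := LG _ e4.
(* A uniform error [c] costs at most [e / 4] in L^1; the summand [1] covers a measure of zero
   mass. *)
pose c := e / 4 / (fine (m setT) + 1).
have mu1 : 0 < fine (m setT) + 1 by rewrite ltr_wpDl.
have c0 : 0 < c by rewrite divr_gt0.
have cmu : c * fine (m setT) <= e / 4.
  by rewrite /c mulrAC ler_pdivrMr// ler_pM2l// lerDl.
have [g [Ag guv glip]] := subalgebra_min sA uA Au Av c0.
have uLIP := AL Au; have vLIP := AL Av; have gLIP := AL Ag.
exists g; split => //.
  have di := dist_integrable m uLIP FL; have di' := dist_integrable m vLIP GL.
  apply: (@le_trans _ _ (c * fine (m setT) + \int[m]_x (`|u x - F x| + `|v x - G x|))).
    apply: Rintegral_le_cstD; first exact: ltW.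
    - by apply: dist_integrable => //; exact: LIPb_min.
    - by have := integrableD measurableT di di'; apply: eq_integrable.
    move=> x; have -> : g x - Num.min (F x) (G x) = (g x - Num.min (u x) (v x)) +
        (Num.min (u x) (v x) - Num.min (F x) (G x)) by rewrite addrA subrK.
    by apply: (le_trans (ler_normD _ _)); apply: lerD (guv x) (dist_min_le _ _ _ _).
  rewrite RintegralD//; apply: (le_trans (lerD cmu (lerD uF vG))).
  exact: quarters3_le.
have ei := excess_integrable m L uLIP; have ei' := excess_integrable m L vLIP.
apply: (@le_trans _ _
  (\int[m]_x (Num.max (slope u x - L) 0 + Num.max (slope v x - L) 0))).
  apply: le_Rintegral => //.
  - exact: excess_integrable.
  - by have := integrableD measurableT ei ei'; apply: eq_integrable.
  by move=> x _; apply: excess_le_max; exact: slope_le_max.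
rewrite RintegralD//; apply: (le_trans (lerD uL vL)).
exact: quarters2_le.
Qed.

End approximable.

(** * Truncated distances *)

Section mazur.
Context {d : measure_display} {R : realType} {X : borelMetricType d R}.
Variables (m : {finite_measure set X -> \bar R}) (A : set (X -> R)).
Hypotheses (gA : good_subalgebra m A).
Implicit Types (F G f g u v : X -> R) (L e : R).

Local Notation L1 := (LfunType m (Order.le_refl (1%E : \bar _))).

Let sA : subalgebra_LIPb A. Proof. by case: gA. Qed.
Let uA : unital A. Proof. by case: gA. Qed.

Lemma L1_integrable (h : L1) : m.-integrable setT (EFin \o h).
Proof. by apply/Lfun1_integrable; exact: LfunP. Qed.

Lemma integrable_funrpos_L1 (h : L1) :
  m.-integrable setT (EFin \o (fun x => Num.max (h x) 0)).
Proof. exact: integrable_funrpos (L1_integrable h). Qed.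

(** A one-sided L^1 norm: on a difference [h - l] it sees only where [h] exceeds [l]. *)
Definition pos_mass (h : L1) : R := \int[m]_x Num.max (h x) 0.

Lemma pos_mass_sublinear : sublinear pos_mass.
Proof.
split=> [h k|t h t0].
  rewrite -RintegralD//; [|exact: integrable_funrpos_L1..].
  apply: le_Rintegral => //; first exact: integrable_funrpos_L1.
    have := integrableD measurableT (integrable_funrpos_L1 h) (integrable_funrpos_L1 k).
    by apply: eq_integrable.
  by move=> x _; exact: max0D_le.
rewrite -RintegralZl//; last exact: integrable_funrpos_L1.
apply: le_Rintegral => //; first exact: integrable_funrpos_L1.
  have := integrableZl measurableT t (integrable_funrpos_L1 h).
  by apply: eq_integrable.
by move=> x _ /=; rewrite maxr_pMr// mulr0.
Qed.

Lemma pos_mass_le_norm (h : L1) : pos_mass h <= \int[m]_x `|h x|.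
Proof.
apply: le_Rintegral => //; first exact: integrable_funrpos_L1.
  by apply: integrable_norm; exact: L1_integrable.
by move=> x _; rewrite ge_max ler_norm normr_ge0.
Qed.

(** Domination at [h] and at [- h] bounds [|phi h|] by the L^1 norm of [h]. The functional from
    Mazur-Orlicz can thus be tested against weak convergence. *)
Lemma pos_mass_dominates_continuous (phi : {scalar L1}) :
  (forall h, phi h <= pos_mass h) -> continuous_functional phi.
Proof.
move=> phip; exists 1 => h.
rewrite mul1e Lnorm1_Rintegral ?lee_fin; last exact: L1_integrable.
rewrite ler_norml lerNl -raddfN; apply/andP; split.
  apply: (le_trans (phip _)); apply: (le_trans (pos_mass_le_norm _)).
  by under eq_Rintegral do rewrite /= normrN.
exact: le_trans (phip _) (pos_mass_le_norm _).
Qed.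

Lemma cvg_L1_Rintegral (f_ : nat -> X -> R) F : (forall n, LIPb (f_ n)) -> LIPb F ->
  cvg_L1 m (fun n => EFin \o f_ n) (EFin \o F) ->
  forall e, 0 < e -> \forall n \near \oo, \int[m]_x `|f_ n x - F x| <= e.
Proof.
move=> fL FL [_ _]; pose a n := \int[m]_x `|f_ n x - F x|.
rewrite (_ : (fun n => _) = EFin \o a); last first.
  apply/funext => n /=; rewrite /a -Lnorm1_Rintegral//.
  have := integrableB measurableT (LIPb_integrable m (fL n)) (LIPb_integrable m FL).
  by apply: eq_integrable.
move=> /fine_cvg/cvgrPdist_le H e e0.
have := H e e0; apply: filterS => n; rewrite sub0r normrN /=.
by apply: le_trans; exact: ler_norm.
Qed.

(* Mazur's lemma for weak convergence of the slopes: [D] consists of the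
   integrable majorants of slopes of functions of [A] close to the truncated
   distance; it is convex because the slope is. *)
Lemma approximable_dist (x : X) (r : R) : 0 < r ->
  approximable m A 1 (fun y => Num.min (mdist x y) r).
Proof.
move=> r0 e e0; pose F y := Num.min (mdist x y) r.
have FL : LIPb F by exact: LIPb_dist.
have [_ _ _ /(_ x r r0)[f_ [rho [Af [_ rho01] fF [U [L [Uf Lrho wk]]]]]]] := gA.
have fL n : LIPb (f_ n) by exact: subalgebra_LIP (Af n).
have UE n y : U n y = slope (f_ n) y.
  by apply: EFin_inj; rewrite slopeE// -Uf.
have LE y : L y = rho y by apply: EFin_inj; have := congr1 (@^~ y) Lrho.
pose D : set L1 := [set h | exists2 g, A g &
  [/\ forall y, slope g y <= h y & \int[m]_y `|g y - F y| <= e]].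
have UD : \forall n \near \oo, D (U n).
  have := cvg_L1_Rintegral fL FL fF e0; apply: filterS => n fn.
  by exists (f_ n) => //; split => // y; rewrite UE.
have cD : convex_subset [set h - L | h in D].
  move=> _ _ t [h [g Ag [gh gF]] <-] [k [v Av [vk vF]] <-] t0 t1.
  have t1' : 0 <= 1 - t by lra.
  have gL := subalgebra_LIP sA Ag; have vL := subalgebra_LIP sA Av.
  exists (t *: h + (1 - t) *: k); last first.
    by rewrite !scalerBr addrACA -opprD -scalerDl addrCA subrr addr0 scale1r.
  exists (fun y => t * g y + (1 - t) * v y); first exact: subalgebra_lin.
  have wL := subalgebra_LIP sA (subalgebra_lin sA t (1 - t) Ag Av).
  split => [y|].
    apply: (le_trans (slopeD y t0 t1' gL vL wL)) => /=.
    by apply: lerD; apply: ler_wpM2l.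
  have di := dist_integrable m gL FL; have di' := dist_integrable m vL FL.
  have ti : m.-integrable setT (EFin \o (fun y => t * `|g y - F y|)).
    by have := integrableZl measurableT t di; apply: eq_integrable.
  have ti' : m.-integrable setT (EFin \o (fun y => (1 - t) * `|v y - F y|)).
    by have := integrableZl measurableT (1 - t) di'; apply: eq_integrable.
  apply: (@le_trans _ _ (\int[m]_y (t * `|g y - F y| + (1 - t) * `|v y - F y|))).
    apply: le_Rintegral => //; first exact: dist_integrable.
      by have := integrableD measurableT ti ti'; apply: eq_integrable.
    move=> y _.
    have -> : t * g y + (1 - t) * v y - F y =
      t * (g y - F y) + (1 - t) * (v y - F y) by ring.
    by apply: (le_trans (ler_normD _ _)); rewrite !normrM (ger0_norm t0) (ger0_norm t1').
  rewrite RintegralD// !RintegralZl//.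
  have := ler_wpM2l t0 gF; have := ler_wpM2l t1' vF; lra.
(* Otherwise some continuous [phi] has [phi (h - L) >= e] for all [h] in [D], although [U n] is
   eventually in [D] and [phi (U n)] tends to [phi L]. *)
have [h [g Ag [gh gF]] hL] : exists2 h, D h & pos_mass (h - L) < e.
  apply: contrapT => noh.
  have big h : D h -> e <= pos_mass (h - L).
    by move=> Dh; rewrite leNgt; apply/negP => lt; apply: noh; exists h.
  have D0 : [set h - L | h in D] !=set0.
    have [N _ /(_ N (leqnn N)) DN] := UD.
    by exists (U N - L); exists (U N).
  have bigD k : [set h - L | h in D] k -> e <= pos_mass k.
    by move=> [h Dh <-]; exact: big.
  have [phi [phip phiD]] := mazur_orlicz pos_mass_sublinear D0 cD bigD.
  have := wk phi (pos_mass_dominates_continuous phip).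
  move=> /cvgrPdist_lt/(_ e e0) phiU.
  have [N _ /(_ N (leqnn N))[/= DN]] := filterI UD phiU.
  have := phiD _ (ex_intro2 _ _ (U N) DN erefl).
  by rewrite raddfB ltr_norml => ? /andP[? ?]; lra.
exists g; split => //.
apply: (@le_trans _ _ (pos_mass (h - L))); last exact: ltW.
apply: ae_le_Rintegral => //.
- by move=> y; rewrite le_max lexx orbT.
- by move=> y; rewrite le_max lexx orbT.
- by apply: excess_integrable; exact: subalgebra_LIP Ag.
- exact: integrable_funrpos_L1.
(* Since [rho <= 1] almost everywhere, the excess over 1 is at most the excess over [rho]. *)
apply: filterS rho01 => y /andP[_ rho1] /=.
apply: (@le_trans _ _ (Num.max (h y - L y) 0)); last exact: lexx.
rewrite LE.
have := gh y; rewrite ge_max !le_max lexx orbT andbT => ?.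
by apply/orP; left; lra.
Qed.

End mazur.

(** * McShane extensions *)

Section mcshane.
Context {d : measure_display} {R : realType} {X : borelMetricType d R}.
Implicit Types (f : X -> R) (L M r : R) (s : seq X) (x y : X).

(** Finite McShane formula. Distances are truncated at [r], as in the definition of a good
    subalgebra, and the starting value [M] caps the function. *)
Definition mcshane f L M r s : X -> R :=
  foldr (fun y acc x => Num.min (f y + L * Num.min (mdist y x) r) (acc x))
    (cst M) s.

Lemma mcshane_LIPb f L M r s : 0 < r -> LIPb (mcshane f L M r s).
Proof.
move=> r0; elim: s => [|y s IH] /=; first exact: LIPb_cst.
by apply: LIPb_min => //; apply: LIPb_affine; exact: LIPb_dist.
Qed.

(** Where the distance is truncated, the competitor is [f y + L * r >= - M + 2 * M], hence at least
    [f x]. If [L = 0], then [f] is constant. *)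
Lemma le_mcshane f L M r s x : 0 <= L -> lipschitz_bound f L setT ->
  (forall y, `|f y| <= M) -> (L = 0 \/ 2 * M <= L * r) ->
  f x <= mcshane f L M r s x.
Proof.
move=> L0 fL fM Lr; elim: s => [|y s IH] /=.
  exact: le_trans (ler_norm _) (fM x).
rewrite le_min IH andbT.
have := fL x y I I; have := fM x; have := fM y; rewrite metric_sym !ler_norml.
case: (leP (mdist y x) r) => _ /andP[? ?] /andP[? ?] /andP[? ?]; first by lra.
by case: Lr => [L0'|?]; [move: L0' => ?; subst L; lra|lra].
Qed.

Lemma mcshane_le_cst f L M r s x : mcshane f L M r s x <= M.
Proof. by elim: s => [|y s IH] //=; rewrite ge_min IH orbT. Qed.

Lemma mcshane_le f L M r s x y : 0 <= L -> y \in s ->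
  mcshane f L M r s x <= f y + L * mdist y x.
Proof.
move=> L0; elim: s => [|z s IH] //=; rewrite in_cons => /orP[/eqP<-|/IH ys].
  by rewrite ge_min lerD2l ler_wpM2l// ge_min lexx.
by rewrite ge_min ys orbT.
Qed.

Lemma approximable_mcshane (m : {finite_measure set X -> \bar R})
    (A : set (X -> R)) f L M r s : good_subalgebra m A -> 0 <= L -> 0 < r ->
  approximable m A L (mcshane f L M r s).
Proof.
move=> gA L0 r0; have [sA uA _ _] := gA.
elim: s => [|y s IH] /=; first exact: approximable_cst.
apply: approximable_min => //.
- by apply: LIPb_affine; exact: LIPb_dist.
- exact: mcshane_LIPb.
(* Truncated distances have bound 1, and scaling by [L] turns it into [L * 1]. *)
rewrite -[X in approximable _ _ X]mulr1; apply: approximable_affine => //.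
- exact: LIPb_dist.
- exact: approximable_dist.
Qed.

End mcshane.

(** * Finite nets, and compact sets of almost full measure *)

Section totally_bounded.
Context {d : measure_display} {R : realType} {X : borelMetricType d R}.

Lemma compact_net (K : set X) (r : R) : 0 < r -> compact K ->
  exists s : seq X, forall x, K x -> exists2 y, y \in s & mdist y x < r.
Proof.
move=> r0; rewrite compact_cover => cK.
have := cK X setT (fun y => ball y r); case.
- by move=> y _; exact: open_ball.
- by move=> x Kx; exists x => //; exact: ballxx.
move=> D _ KD; exists (finmap.enum_fset D) => x /KD[y yD yx].
by exists y => //; rewrite -ballP.
Qed.

(** As [m] is finite, [m setT - e] is strictly below the supremum over compact sets. Compact sets
    are closed in a metric space, hence Borel. *)
Lemma inner_regular_compact (m : {finite_measure set X -> \bar R}) (e : R) :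
  inner_regular m -> 0 < e ->
  exists K : set X, [/\ compact K, measurable K & fine (m (~` K)) <= e].
Proof.
move=> mreg e0; have := mreg setT measurableT.
move=> E; have : (m setT - e%:E < m setT)%E.
  by rewrite lteBlDr ?fin_num_measure// lteDl ?fin_num_measure// lte_fin.
rewrite {2}E => /ereal_sup_gt[_ [K [cK _] <-] mK].
have measK : measurable K.
  rewrite -[K]setCK; apply: measurableC; apply: open_measurable_borel.
  by apply: closed_openC; apply: compact_closed => //; exact: metric_hausdorff.
exists K; split => //.
rewrite -lee_fin fineK ?fin_num_measure//; last exact: measurableC.
rewrite -setTD measureD// ?setTI; last by rewrite ltey_eq fin_num_measure.
by rewrite leeBlDr ?fin_num_measure// -leeBlDl ?fin_num_measure// ltW.
Qed.

End totally_bounded.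

(** * Density and domination *)

Section density.
Context {d : measure_display} {R : realType} {X : borelMetricType d R}.
Variables (m : {finite_measure set X -> \bar R}) (A : set (X -> R)).
Hypotheses (mreg : inner_regular m) (gA : good_subalgebra m A).
Implicit Types (f g : X -> R) (L e : R).

Let sA : subalgebra_LIPb A. Proof. by case: gA. Qed.
Let uA : unital A. Proof. by case: gA. Qed.
Let mass_ge0 : 0 <= fine (m setT). Proof. exact: fine_ge0. Qed.

(** On [K], a net point [y] bounds the extension by [f y + L * eta <= f x + 2 * L * eta]. Off [K],
    the extension is at most [M] and [f] at least [- M]. *)
Lemma dist_mcshane_le f L M r eta s (K : set X) x :
  0 <= L -> 0 <= M -> 0 < eta -> lipschitz_bound f L setT ->
  (forall y, `|f y| <= M) -> (L = 0 \/ 2 * M <= L * r) ->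
  (K x -> exists2 y, y \in s & mdist y x < eta) ->
  `|mcshane f L M r s x - f x| <= 2 * L * eta + 2 * M * \1_(~` K) x.
Proof.
move=> L0 M0 eta0 fL fM Lr net.
have fG := le_mcshane s x L0 fL fM Lr.
rewrite ger0_norm ?subr_ge0//.
have [Kx|Kx] := pselect (K x); last first.
  rewrite indicE mem_set// mulr1; have := mcshane_le_cst f L M r s x.
  have := fM x; rewrite ler_norml => /andP[? _] ?.
  have : 0 <= L * eta by rewrite mulr_ge0// ltW.
  by rewrite -mulrA; lra.
rewrite indicE memNset ?mulr0 ?addr0; last by [].
have [y ys yx] := net Kx.
have := mcshane_le f M r x L0 ys; have := fL y x I I.
have : L * mdist y x <= L * eta by rewrite ler_wpM2l// ltW.
by rewrite -mulrA ler_norml => ? /andP[? ?] ?; lra.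
Qed.

Lemma dense_mcshane f e : LIPb f -> 0 < e ->
  exists2 G, LIPb G /\ approximable m A (fine (Lip f setT)) G &
    \int[m]_x `|G x - f x| <= e.
Proof.
move=> fLIP e0; have [L0 fL] := LIPb_lipschitz fLIP.
have [M M0 fM] := LIPb_bounded fLIP.
set L := fine (Lip f setT) in L0 fL *; pose mu := fine (m setT).
(* This gives [L * r >= 2 * M] for nonzero [L]. For [L = 0] the quotient is 0 by convention, and the
   summand [1] keeps [r] positive. *)
pose r := 2 * M / L + 1.
have r0 : 0 < r by rewrite ltr_wpDl// divr_ge0// mulr_ge0.
have Lr : L = 0 \/ 2 * M <= L * r.
  have [->|Ln0] := eqVneq L 0; [by left|right].
  by rewrite /r mulrDr mulr1 mulrCA divff// mulr1 lerDl.
have mu1 : 0 < mu + 1 by rewrite ltr_wpDl.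
have L1 : 0 < 2 * L + 1 by rewrite ltr_wpDl// mulr_ge0.
have M1 : 0 < 2 * M + 1 by rewrite ltr_wpDl// mulr_ge0.
(* Chosen so that the error [2 * L * eta] integrates to at most [e / 4]; the summands [1] exclude a
   zero denominator. *)
pose eta := e / 4 / ((2 * L + 1) * (mu + 1)).
have e4 : 0 < e / 4 by rewrite divr_gt0.
have eta0 : 0 < eta by rewrite divr_gt0// mulr_gt0.
(* The error off [K], at most [2 * M], then also integrates to at most [e / 4]. *)
have [K [cK mK Ke]] := inner_regular_compact mreg (divr_gt0 e4 M1).
have [s net] := compact_net eta0 cK.
have GL := mcshane_LIPb f L M s r0.
exists (mcshane f L M r s); first by split => //; exact: approximable_mcshane.
have mKC : measurable (~` K) by exact: measurableC.
have iK : m.-integrable setT (EFin \o (\1_(~` K) : X -> R)).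
  exact: integrable_indic.
have iK2 : m.-integrable setT (EFin \o (fun x => 2 * M * \1_(~` K) x)).
  by have := integrableZl measurableT (2 * M) iK; apply: eq_integrable.
apply: (le_trans (Rintegral_le_cstD (c := 2 * L * eta) _ _ iK2 _)).
- by apply: mulr_ge0; [exact: mulr_ge0|exact: ltW].
- exact: dist_integrable.
- by move=> x; apply: dist_mcshane_le => //; exact: net.
rewrite RintegralZl// [X in _ + _ * X]/Rintegral integral_indic// setIT.
have h1 : 2 * L * eta * mu <= e / 4.
  have -> : 2 * L * eta * mu = e / 4 * (2 * L * mu) / ((2 * L + 1) * (mu + 1)).
    by rewrite /eta; ring.
  rewrite ler_pdivrMr ?mulr_gt0// ler_pM2l//; apply: ler_pM => //.
  - by rewrite mulr_ge0.
  - by rewrite lerDl.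
  - by rewrite lerDl.
have h2 : 2 * M * fine (m (~` K)) <= e / 4.
  apply: (@le_trans _ _ ((2 * M + 1) * (e / 4 / (2 * M + 1)))).
    apply: ler_pM => //; first by rewrite mulr_ge0.
      exact: fine_ge0.
    by rewrite lerDl.
  by rewrite mulrC divfK// gt_eqF.
exact: le_trans (lerD h1 h2) (quarters2_le e0).
Qed.

Definition clamp (lo hi t : R) : R := Num.max lo (Num.min t hi).

Lemma clamp_bounds lo hi t : lo <= hi -> lo <= clamp lo hi t <= hi.
Proof.
by move=> lohi; rewrite le_max lexx/= ge_max lohi ge_min lexx orbT.
Qed.

Lemma clamp_dist lo hi s t : `|clamp lo hi s - clamp lo hi t| <= `|s - t|.
Proof.
have h1 : `|Num.min s hi - Num.min t hi| <= `|s - t|.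
  by have := dist_min_le s hi t hi; rewrite subrr normr0 addr0.
apply: le_trans h1; rewrite /clamp.
move: (Num.min s hi) (Num.min t hi) => a b.
have := ler_norm (a - b); have := ler_norm (- (a - b)); rewrite normrN ler_norml.
by case: (leP lo a) => ?; case: (leP lo b) => ? ? ?; apply/andP; split; lra.
Qed.

(** Boundedness of [f] is what makes the real [inf] and [sup] of the range genuine bounds. *)
Lemma LIPb_range f x : LIPb f -> inf (range f) <= f x <= sup (range f).
Proof.
move=> /LIPb_bounded[M M0 fM]; apply/andP; split.
  apply: ge_inf; last by exists x.
  by exists (- M) => _ [y _ <-]; have := fM y; rewrite ler_norml => /andP[].
apply: ub_le_sup; last by exists x.
by exists M => _ [y _ <-]; exact: le_trans (ler_norm _) (fM y).
Qed.

(** Three approximations in a row: [f] by a McShane function [G], [G] by [h] in [A], and the clamped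
    [h] by a Bernstein polynomial [g] of [h]. Increments of [g] are below those of [h], so the last
    one does not enlarge the slope. *)
Lemma approximable_LIPb f e : LIPb f -> 0 < e ->
  exists g, [/\ A g, forall x, inf (range f) <= g x <= sup (range f),
    \int[m]_x `|g x - f x| <= e &
    \int[m]_x Num.max (slope g x - fine (Lip f setT)) 0 <= e].
Proof.
move=> fLIP e0; set L := fine _.
have e4 : 0 < e / 4 by rewrite divr_gt0.
have [G [GLIP aG] Gf] := dense_mcshane fLIP e4.
have [h [Ah hG hL]] := aG _ e4; have hLIP := subalgebra_LIP sA Ah.
set lo := inf _; set hi := sup _.
have frange x : lo <= f x <= hi by exact: LIPb_range.
have lohi : lo <= hi by have /andP[a b] := frange point; exact: le_trans a b.
pose mu := fine (m setT); pose c := e / 4 / (mu + 1).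
have mu1 : 0 < mu + 1 by rewrite ltr_wpDl.
have c0 : 0 < c by rewrite divr_gt0.
have cmu : c * mu <= e / 4.
  by rewrite /c mulrAC ler_pdivrMr// ler_pM2l// lerDl.
have [g [Ag gh glip grange]] := subalgebra_comp sA uA Ah c0 (clamp_dist lo hi).
have gLIP := subalgebra_LIP sA Ag.
exists g; split => //.
- by apply: grange => t; exact: clamp_bounds.
- have iG := dist_integrable m hLIP GLIP; have iF := dist_integrable m GLIP fLIP.
  apply: (@le_trans _ _ (c * mu + \int[m]_x (`|h x - G x| + `|G x - f x|))).
    apply: Rintegral_le_cstD; first exact: ltW.
    - exact: dist_integrable.
    - by have := integrableD measurableT iG iF; apply: eq_integrable.
    move=> x.
    (* Since [f] is its own clamping and clamping is 1-Lipschitz, clamping does not move [h] away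
       from [f]. *)
    have -> : g x - f x = (g x - clamp lo hi (h x)) +
        (clamp lo hi (h x) - clamp lo hi (f x)).
      rewrite addrA subrK; congr (_ - _).
      by have /andP[? ?] := frange x; rewrite /clamp min_l// max_r.
    apply: (le_trans (ler_normD _ _)); apply: (lerD (gh x)).
    exact: le_trans (clamp_dist _ _ _ _) (ler_distD _ _ _).
  rewrite RintegralD//; apply: (le_trans (lerD cmu (lerD hG Gf))).
  exact: quarters3_le.
apply: (@le_trans _ _ (e / 4)); last by rewrite ler_pdivrMr// ler_peMr// ?ler1n// ltW.
apply: le_trans hL; apply: le_Rintegral => //; try exact: excess_integrable.
move=> x _; rewrite ge_max !le_max lexx orbT andbT lerD2r.
by rewrite slope_le_comp.
Qed.

End density.

(** * L^1 convergence from a rate, and domination by a summable series *)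

Section subsequence.
Context {d : measure_display} {R : realType} {X : borelMetricType d R}.
Variables (m : {finite_measure set X -> \bar R}).
Implicit Types (f g h : X -> R).

Lemma cvg_L1_dist (h_ : nat -> X -> R) h (e_ : nat -> R) :
  (forall n, m.-integrable setT (EFin \o h_ n)) ->
  m.-integrable setT (EFin \o h) ->
  (forall n, \int[m]_x `|h_ n x - h x| <= e_ n) -> e_ n @[n --> \oo] --> 0 ->
  cvg_L1 m (fun n => EFin \o h_ n) (EFin \o h).
Proof.
move=> ih_ ih he e0; split => //.
rewrite (_ : (fun n => _) = EFin \o (fun n => \int[m]_x `|h_ n x - h x|)).
  apply: cvg_EFin; first by near=> n.
  apply: (squeeze_cvgr _ (cvg_cst 0) e0); near=> n => /=.
  by rewrite he Rintegral_ge0.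
apply/funext => n /=; rewrite -Lnorm1_Rintegral//.
by have := integrableB measurableT (ih_ n) ih; apply: eq_integrable.
Unshelve. all: by end_near. Qed.

(** The dominating function is the sum of the series. Its integral is at most the sum [C] of the
    bounds, so it is finite almost everywhere. *)
Lemma summable_domination (h_ : nat -> X -> R) (C : R) :
  (forall n x, 0 <= h_ n x) ->
  (forall n, m.-integrable setT (EFin \o h_ n)) -> 0 <= C ->
  (forall n, \int[m]_x h_ n x <= C / (2 ^ n.+1)%:R) ->
  exists G : X -> R, [/\ m.-integrable setT (EFin \o G), forall x, 0 <= G x &
    forall n, {ae m, forall x, h_ n x <= G x}].
Proof.
move=> h0 ih C0 hC.
pose S x := (\sum_(0 <= n <oo) (h_ n x)%:E)%E.
have S0 x : (0 <= S x)%E by apply: nneseries_ge0 => n _ _; rewrite lee_fin.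
have mS : measurable_fun setT S.
  apply: ge0_emeasurable_sum => [n x _ _|n _]; first by rewrite lee_fin.
  exact: measurable_int (ih n).
have iS : m.-integrable setT S.
  apply/integrableP; split => //.
  under eq_integral do rewrite gee0_abs//.
  rewrite integral_nneseries//; last first.
  - by move=> n x _; rewrite lee_fin.
  - by move=> n; exact: measurable_int (ih n).
  apply: (@le_lt_trans _ _ C%:E); last exact: ltry.
  apply: le_trans (epsilon_trick0 xpredT C0); apply: lee_nneseries => [n _ _|n _].
    by apply: integral_ge0 => x _; rewrite lee_fin.
  rewrite -[leLHS]fineK; first by rewrite lee_fin; exact: hC.
  by apply: integrable_fin_num => //; exact: ih.
(* [fine] returns 0 where the series diverges, so domination holds only almost everywhere. *)
exists (fine \o S); split.
- apply: (le_integrable measurableT _ _ iS).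
    apply/measurable_EFinP; apply: measurableT_comp => //.
  move=> x _ /=; rewrite gee0_abs// ger0_norm ?fine_ge0//.
  by case: (S x) (S0 x) => //= *; rewrite leey.
- by move=> x; exact: fine_ge0.
move=> n; have := integrable_ae measurableT iS; apply: filterS => x /(_ I) Sfin.
rewrite -lee_fin /= fineK//.
have h0' i : (0 <= i)%N -> xpredT i -> (0 <= (h_ i x)%:E)%E.
  by move=> _ _; rewrite lee_fin.
(* The partial sum over indices below [n.+1] is the first to contain the term [n]. *)
apply: le_trans (nneseries_lim_ge n.+1 h0').
rewrite big_nat_recr//= leeDr//; apply: sume_ge0 => i _; by rewrite lee_fin.
Qed.

End subsequence.

Theorem proposition4p4 (d : measure_display) (R : realType)
    (X : borelMetricType d R) (m : {finite_measure set X -> \bar R})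
    (A : set (X -> R)) (f : X -> R) :
  inner_regular m -> good_subalgebra m A -> LIPb f ->
  exists f_ : nat -> X -> R,
    (forall n, A (f_ n)) /\
    [/\ forall n x, inf (range f) <= f_ n x <= sup (range f),
        cvg_L1 m (fun n => EFin \o f_ n) (EFin \o f),
        exists G : X -> R,
          [/\ m.-integrable setT (EFin \o G),
              forall x, 0 <= G x
            & forall n, {ae m, forall x, (lip_a (f_ n) x <= (G x)%:E)%E}]
      & cvg_L1 m
          (fun n => ((fun x => lip_a (f_ n) x - Lip f setT)^\+)%E)
          (cst 0%E)].
Proof.
move=> mreg gA fLIP; have [sA _ _ _] := gA.
(* The rate [2^-(n+1)] tends to 0 and sums to 1, so it serves both convergence and domination. *)
pose L := fine (Lip f setT); pose e_ n : R := 1 / (2 ^ n.+1)%:R.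
have e_gt0 n : 0 < e_ n by rewrite divr_gt0// ltr0n expn_gt0.
have e_cvg : e_ n @[n --> \oo] --> 0.
  rewrite (_ : e_ = geometric 2^-1 2^-1).
    by apply: cvg_geometric; rewrite ger0_norm ?invr_ge0// invf_lt1 ?ltr1n.
  by apply/funext => n; rewrite /e_ /geometric/= natrX div1r exprVn exprS invfM.
have [f_ Hf] := choice (fun n => approximable_LIPb mreg gA fLIP (e_gt0 n)).
have Af n : A (f_ n) by case: (Hf n).
have f_LIP n : LIPb (f_ n) by exact: subalgebra_LIP (Af n).
pose ex n x := Num.max (slope (f_ n) x - L) 0.
have ex_ge0 n x : 0 <= ex n x by rewrite le_max lexx orbT.
have ex_int n : m.-integrable setT (EFin \o ex n) by exact: excess_integrable.
have ex_le n : \int[m]_x ex n x <= e_ n by case: (Hf n).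
exists f_; split => //; split.
- by move=> n; case: (Hf n).
- apply: (cvg_L1_dist _ _ _ e_cvg).
  + by move=> n; exact: LIPb_integrable.
  + exact: LIPb_integrable.
  + by move=> n; case: (Hf n).
- have [G [iG G0 exG]] := summable_domination ex_ge0 ex_int ler01 ex_le.
  (* Each slope is at most [L] plus its excess over [L], and [G] dominates all the excesses. *)
  exists (fun x => L + G x); split.
  + have iL : m.-integrable setT (EFin \o cst L).
      exact: finite_measure_integrable_cst.
    by have := integrableD measurableT iL iG; apply: eq_integrable.
  + by move=> x; rewrite addr_ge0// fine_ge0// Lip_ge0.
  move=> n; have := exG n; apply: filterS => x.
  rewrite -slopeE// lee_fin -lerBlDl; apply: le_trans.
  by rewrite le_max lexx.
(* Both [lip_a (f_ n) x] and [Lip f setT] are finite, so the positive part in [\bar R] is the real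
   excess. *)
rewrite (_ : (fun n => _) = (fun n => EFin \o ex n)); last first.
  apply/funext => n; apply/funext => x.
  by rewrite funeposE /= -(LIPb_fineK fLIP) -slopeE// -EFinB -EFin_max.
rewrite (_ : cst 0%E = EFin \o (cst 0 : X -> R))//.
apply: (cvg_L1_dist ex_int _ _ e_cvg).
  exact: finite_measure_integrable_cst.
move=> n; apply: le_trans (ex_le n).
by under eq_Rintegral do rewrite subr0 ger0_norm//.
Qed.
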